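(* Let $p\geq3$ be an integer and $0<\beta\leq\beta_{\mathrm{sh}}(p)$. With $$\Delta_{p,\beta}(s)=\sup_{u\in\mathbb{R}}\Phi_{p,\beta}(u,\sqrt s)-\frac{\beta^2}{2},\qquad 0\leq s<1,\qquad s_*=\frac{p-2}{p-1},$$ one has $$\operatorname{sgn}\Delta_{p,\beta}(s)=\begin{cases}1,&0\leq s<s_*,\\ 0,&s=s_*,\\ -1,&s_*<s<1.\end{cases}$$ At $s=s_*$ the maximizing energy $u$ (the maximizer of $u\mapsto\Phi_{p,\beta}(u,\sqrt{s_*})$ over $\mathbb{R}$) is unique and equals $$u^*_{p,\beta}=\frac{2(p-1)}{p-2}\,\beta\, s_*^{p/2}.$$ In particular, $u^*_{p,\beta_{\mathrm{sh}}(p)}=u_{\infty,p}$.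
   Context: For an integer $p\geq3$ set $$u_{\infty,p}=2\sqrt{\frac{p-1}{p}},\qquad \beta_{\mathrm{sh}}(p)=\sqrt{\frac{(p-1)^{p-1}}{p(p-2)^{p-2}}}.$$ Let $\mu_{\mathrm{sc}}(d\lambda)=\frac{\sqrt{4-\lambda^2}}{2\pi}\mathbf{1}_{\{|\lambda|\leq2\}}d\lambda$ be the semicircle law and $$\Omega(x)=\int_{-2}^2\log|x-\lambda|\,\mu_{\mathrm{sc}}(d\lambda).$$ For $u\in\mathbb{R}$ define $$\Sigma_p(u)=\frac12+\frac12\log(p-1)-\frac{u^2}{2}+\Omega\left(\sqrt{\frac{p}{p-1}}\,u\right).$$ For $t\in(-1,1)$ let $v_p(t)=1-t^{2p}-p\,t^{2p-2}(1-t^2)$, and for $\beta>0$ define $$\Phi_{p,\beta}(u,t)=\Sigma_p(u)+\beta t^p u+\frac12\log(1-t^2)+\frac{\beta^2}{2}v_p(t).$$ *)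

(* Defs.v *)
From HB Require Import structures.
From mathcomp Require Import all_boot all_order all_algebra.
From mathcomp Require Import all_classical all_reals all_analysis.
From mathcomp Require Import measurable_realfun.

Set Implicit Arguments.
Unset Strict Implicit.
Unset Printing Implicit Defensive.

Import Order.TTheory GRing.Theory Num.Theory.
Import numFieldNormedType.Exports.

Local Open Scope classical_set_scope.
Local Open Scope ring_scope.

Section semicircle.
Context {R : realType}.
Notation mu := (@lebesgue_measure R).

Definition semicircle_pdf (x : R) : R :=
  Num.sqrt (4 - x ^+ 2) / (2 * pi) * \1_[set y | `|y| <= 2] x.

Lemma semicircle_pdf_ge0 x : 0 <= semicircle_pdf x.
Proof.
by rewrite mulr_ge0 ?divr_ge0 ?sqrtr_ge0 ?mulr_ge0 ?pi_ge0//.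
Qed.

Lemma measurable_semicircle_pdf : measurable_fun [set: R] semicircle_pdf.
Proof.
apply: measurable_funM; last first.
  apply: measurable_indic; rewrite (_ : [set y | _] = [set` `[-2, 2]])//.
  by apply/seteqP; split => y /=; rewrite in_itv/= ler_norml.
apply: measurable_funM => //; apply: continuous_measurable_fun => x.
apply: (@continuous_comp _ _ _ (fun x : R => 4 - x ^+ 2) Num.sqrt).
  by apply: cvgB; [exact: cvg_cst | exact: exprn_continuous].
exact: sqrt_continuous.
Qed.

Definition semicircle_law (A : set (measurableTypeR R)) : \bar R :=
  (\int[mu]_(x in A) (semicircle_pdf x)%:E)%E.

Let semicircle_law0 : semicircle_law set0 = 0%E.
Proof. by rewrite /semicircle_law integral_set0. Qed.

Let semicircle_law_ge0 A : (0 <= semicircle_law A)%E.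
Proof.
by apply: integral_ge0 => x _; rewrite lee_fin semicircle_pdf_ge0.
Qed.

Let semicircle_law_sigma_additive : semi_sigma_additive semicircle_law.
Proof.
move=> /= F mF tF mUF; rewrite /semicircle_law; apply: cvg_toP.
  apply: ereal_nondecreasing_is_cvgn => m n mn.
  apply: lee_sum_nneg_natr => // k _ _; apply: integral_ge0 => /= x Fkx.
  by rewrite lee_fin semicircle_pdf_ge0.
rewrite ge0_integral_bigcup//=.
- apply/measurable_funTS/measurableT_comp => //.
  exact: measurable_semicircle_pdf.
- by move=> x _; rewrite lee_fin semicircle_pdf_ge0.
Qed.

HB.instance Definition _ := isMeasure.Build _ _ _ semicircle_law
  semicircle_law0 semicircle_law_ge0 semicircle_law_sigma_additive.

End semicircle.

(* At l = x, where the true integrand is -oo, [ln 0 = 0]; a single point is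
   negligible for the semicircle law, so the integral is unaffected. *)
Definition Omega {R : realType} (x : R) : R :=
  \int[semicircle_law]_(l in `[-2, 2]) ln `|x - l|.

(* Throughout, [p] is meant to be at least 3, so that the truncated exponents
   [p - 1], [p - 2] and [2 * p - 2] are genuine differences. *)
Section complexity.
Context {R : realType}.
Implicit Types (p : nat) (beta u s t : R).

Definition u_infty p : R := 2 * Num.sqrt ((p%:R - 1) / p%:R).

Definition beta_sh p : R :=
  Num.sqrt ((p%:R - 1) ^+ (p - 1) / (p%:R * (p%:R - 2) ^+ (p - 2))).

Definition Sigma p u : R :=
  1 / 2 + 1 / 2 * ln (p%:R - 1) - u ^+ 2 / 2
  + Omega (Num.sqrt (p%:R / (p%:R - 1)) * u).

Definition v p t : R :=
  1 - t ^+ (2 * p) - p%:R * t ^+ (2 * p - 2) * (1 - t ^+ 2).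

Definition Phi p beta u t : R :=
  Sigma p u + beta * t ^+ p * u + 1 / 2 * ln (1 - t ^+ 2)
  + beta ^+ 2 / 2 * v p t.

Definition Delta p beta s : R :=
  sup [set Phi p beta u (Num.sqrt s) | u in [set: R]] - beta ^+ 2 / 2.

Definition s_star p : R := (p%:R - 2) / (p%:R - 1).

Definition u_star p beta : R :=
  2 * (p%:R - 1) / (p%:R - 2) * beta * s_star p `^ (p%:R / 2).

End complexity.

(* Main.v *)
From HB Require Import structures.
Require Import Defs.
From mathcomp Require Import all_boot all_order all_algebra ring lra.
From mathcomp Require Import all_classical all_reals all_analysis.
From mathcomp Require Import measurable_realfun.

Set Implicit Arguments.
Unset Strict Implicit.
Unset Printing Implicit Defensive.

Import Order.TTheory GRing.Theory Num.Theory.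
Import numFieldNormedType.Exports.

Local Open Scope classical_set_scope.
Local Open Scope ring_scope.

(** The proof computes the logarithmic potential Omega of the semicircle law in
    closed form and turns it into a one-parameter family of parabolas lying
    above Omega, so that every supremum over the energy u becomes the maximum
    of an explicit quadratic polynomial.

    The potential. Write l = 2 cos t and x = 2 cos phi. The semicircle law
    becomes (2 / pi) sin^2 t dt on [0, pi], and (x - l)^2 becomes the product
    of |1 - e^(i(t - phi))|^2 and |1 - e^(i(t + phi))|^2. Replacing the unit
    radius by r < 1 makes the integrand smooth; its integral is 0 at r = 0 and
    its r-derivative is an elementary integral in t, hence
    [integral_logkernel]. The same regularized integral gives the potential
    everywhere. Its limit as r tends to 1 is Omega x = x^2/4 - 1/2 for
    |x| <= 2 ([Omega_bulk]); at phi = 0 or pi, without any limit, it is the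
    potential at the exterior points x = +-(r + 1/r), where
    Omega x = r^2/2 - ln r ([Omega_joukowski]).

    The parabolas. As a function of x^2, Omega is concave: affine up to 4,
    strictly concave beyond. Its tangent at x^2 = (z + 1)^2 / z, for z >= 1,
    is x^2 / (2(z + 1)) + (ln z) / 2 - 1/2, which therefore bounds Omega from
    above for every x ([Omega_le]); the case z = 1 is an equality for
    |x| <= 2.

    The overlap. Put p = n + 2, so s_* = n / (n + 1). Inserting the parabola of
    parameter z into Phi gives a concave quadratic in u whose maximum, minus
    beta^2 / 2, is called crest below. With
    B = beta^2 p s^(p-2) (1 - s) one has B < 1 for s <> s_*: the inequality of
    arithmetic and geometric means shows that s^(p-2) (1 - s) is largest
    exactly at s_*, and beta_sh is the value of beta for which B = 1 there
    ([critical_lt]).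

    - If s <= s_*, the maximizer of the quadratic with z = 1 lies in the region
      where the parabola coincides with Omega ([tilt_bulk]), so Delta equals
      crest at z = 1. This vanishes at s_*, and below s_* it is positive because
      ln (1 + y) >= y / (1 + y) and B < 1 ([crest_gt0]). Uniqueness of the
      maximizing energy is uniqueness of the vertex of a parabola.
    - If s > s_*, the parameter z with (p - 1)(1 - s) z = 1 exceeds 1 and its
      crest is 0. Decreasing it to (p - 1)(1 - s) z = 1 - e turns twice the
      crest into ln (1 - e) + B s e / (s - e), which is negative for small
      e > 0 since B < 1 ([crest_lt0]). *)

(** * The regularized logarithmic integral over the circle *)

Section circle_integral.
Context {R : realType}.
Implicit Types (r phi t : R).
Local Notation leb := (@lebesgue_measure R).

Lemma derivable_continuous (f : R -> R) :
  (forall x, derivable f x 1) -> continuous f.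
Proof. by move=> df x; apply/differentiable_continuous/derivable1_diffP. Qed.

(** This is |1 - r e^(it)|^2. *)
Definition dist2 r t := 1 - 2 * r * cos t + r ^+ 2.

(** The distance from 1 to the circle of radius |r| is 1 - |r|. *)
Lemma dist2_ge r t : (1 - `|r|) ^+ 2 <= dist2 r t.
Proof.
have c1 := @cos_le1 R t; have c2 := @cos_geN1 R t.
rewrite /dist2; case: (ger0P r) => hr; nra.
Qed.

Lemma dist2_gt0 r t : `|r| < 1 -> 0 < dist2 r t.
Proof.
move=> r1; apply: lt_le_trans (dist2_ge r t).
by rewrite exprn_gt0// subr_gt0.
Qed.

Lemma one_sub_rcos_gt0 r t : `|r| < 1 -> 0 < 1 - r * cos t.
Proof.
move=> r1; rewrite subr_gt0 (le_lt_trans (ler_norm _))// normrM.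
rewrite (le_lt_trans _ r1)// ler_piMr// ler_norml cos_geN1 cos_le1//.
Qed.

(** Minus the argument of 1 - r e^(it), continuous and periodic in t when
    |r| < 1; its Fourier series is the sum of r^m sin (m t) / m over m >= 1. *)
Definition argfun r t := atan (r * sin t / (1 - r * cos t)).

(** The Poisson kernel (1 - r^2) / dist2 is 1 plus twice this derivative, so
    argfun yields an antiderivative of 1 / dist2 that is smooth on the whole
    line, whereas the usual substitution tan (t/2) is singular at pi. *)
Lemma is_derive_argfun r t : `|r| < 1 ->
  is_derive t 1 (argfun r) ((r * cos t - r ^+ 2) / dist2 r t).
Proof.
move=> r1; rewrite /argfun.
have h0 := one_sub_rcos_gt0 t r1.
have hn : 1 - r * cos t != 0 by rewrite gt_eqF.
have hD : dist2 r t != 0 by rewrite gt_eqF// dist2_gt0.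
have hS := sin2cos2 t.
apply: is_derive_eq.
rewrite /GRing.scale/= /dist2 in hD *.
move: (cos t) (sin t) hS hn hD => c s hS hn hD; clear h0.
have -> : 1 + (r * s / (1 - r * c)) ^+ 2 =
    (1 - 2 * r * c + r ^+ 2) / (1 - r * c) ^+ 2.
  by field: hS.
by field: hS; rewrite hD hn.
Qed.

Lemma is_derive_ln_dist2 r t : `|r| < 1 ->
  is_derive t 1 (fun t => ln (dist2 r t)) (2 * r * sin t / dist2 r t).
Proof.
move=> r1; have hD := dist2_gt0 t r1.
rewrite /dist2 in hD *.
have h := is_derive1_ln hD.
apply: is_derive_eq.
rewrite /GRing.scale/=; ring.
Qed.

(** An antiderivative in t of the r-derivative of ln (dist2 r t), weighted by
    sin^2 (t + phi). It is read off from the Fourier series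
    - 2 sum_m r^(m-1) cos (m t) of that derivative: multiplying by
    sin^2 (t + phi) = (1 - cos 2t cos 2phi + sin 2t sin 2phi) / 2 shifts the
    frequencies by 2, and resumming the shifted series gives back argfun and
    ln dist2. The summand r t is the only one that is not periodic. *)
Definition dr_prim r phi t :=
  - (argfun r t / r)
  + (cos phi ^+ 2 - sin phi ^+ 2) / 2 *
    ((argfun r t - r * sin t - r ^+ 2 * (sin t * cos t)) / r ^+ 3
     + sin t + r * t + r * argfun r t)
  - sin phi * cos phi *
    ((ln (dist2 r t) / 2 + r * cos t + r ^+ 2 * cos t ^+ 2) / r ^+ 3
      - cos t - r * ln (dist2 r t) / 2).

Lemma is_derive_dr_prim r phi t : r != 0 -> `|r| < 1 ->
  is_derive t 1 (dr_prim r phi)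
   ((2 * r - 2 * cos t) / dist2 r t * sin (t + phi) ^+ 2).
Proof.
move=> r0 r1.
have hD : dist2 r t != 0 by rewrite gt_eqF// dist2_gt0.
have hS := sin2cos2 t.
have hP := sin2cos2 phi.
have ha := is_derive_argfun t r1.
have hl := is_derive_ln_dist2 t r1.
rewrite /dr_prim.
apply: is_derive_eq.
rewrite sinD /GRing.scale/= /dist2 in hD *.
move: (cos t) (sin t) (cos phi) (sin phi) hS hP hD => c s u v hS hP hD.
clear ha hl.
field: hS hP.
by rewrite hD r0.
Qed.

Definition logkernel_dr r phi t : R :=
  ((2 * r - 2 * cos (t - phi)) / dist2 r (t - phi)
   + (2 * r - 2 * cos (t + phi)) / dist2 r (t + phi)) * sin t ^+ 2.

Lemma continuous_logkernel_dr r phi : `|r| < 1 ->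
  continuous (logkernel_dr r phi).
Proof.
move=> r1; apply: derivable_continuous => t.
have h1 : dist2 r (t - phi) != 0 by rewrite gt_eqF// dist2_gt0.
have h2 : dist2 r (t + phi) != 0 by rewrite gt_eqF// dist2_gt0.
rewrite /logkernel_dr /dist2 in h1 h2 *.
exact: ex_derive.
Qed.

(** Integrating over [0, pi] the terms in t - phi and t + phi amounts to
    integrating over a full period of t, so the periodic part of the
    antiderivative cancels and only the linear summand contributes. *)
Lemma integral_logkernel_dr r phi : 0 < r -> r < 1 ->
  (\int[leb]_(t in `[0%R, pi]) (logkernel_dr r phi t)%:E =
   (pi * r * cos (phi *+ 2))%:E)%E.
Proof.
move=> r0 r1.
have nr1 : `|r| < 1 by rewrite gtr0_norm.
have rn0 : r != 0 by rewrite gt_eqF.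
pose H t := dr_prim r phi (t - phi) + dr_prim r (- phi) (t + phi).
have dH t : is_derive t 1 H (logkernel_dr r phi t).
  have k1 := is_derive_dr_prim phi (t - phi) rn0 nr1.
  have k2 := is_derive_dr_prim (- phi) (t + phi) rn0 nr1.
  have s1 : is_derive t 1 (fun t => t - phi) 1.
    by apply: is_derive_eq; rewrite oppr0 addr0.
  have s2 : is_derive t 1 (fun t => t + phi) 1.
    by apply: is_derive_eq; rewrite addr0.
  have c1 := @is_derive1_comp _ _ (fun t => t - phi) _ _ _ k1 s1.
  have c2 := @is_derive1_comp _ _ (fun t => t + phi) _ _ _ k2 s2.
  apply: (is_derive_eq (is_deriveD c1 c2)).
  by rewrite addrK subrK !mulr1 -mulrDl.
have cH : continuous H by apply: derivable_continuous => t; exact: ex_derive.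
rewrite (@continuous_FTC2 _ _ H) ?pi_gt0//.
- rewrite -EFinB; congr EFin.
  have sp x : sin (pi + x) = - sin x :> R by rewrite addrC sinDpi.
  have cp x : cos (pi + x) = - cos x :> R by rewrite addrC cosDpi.
  have e1 : argfun r (- phi) = - argfun r phi.
    by rewrite /argfun sinN cosN mulrN mulNr atanN.
  have e2 : argfun r (pi + phi) = - argfun r (pi - phi).
    by rewrite /argfun !sp !cp sinN cosN opprK !mulrN mulNr atanN opprK.
  have e3 : dist2 r (pi + phi) = dist2 r (pi - phi).
    by rewrite /dist2 !cp cosN.
  rewrite /H /dr_prim !add0r e2 e1 e3.
  rewrite /dist2 !cp !sp !cosN !sinN mulr2n cosD.
  have hS := sin2cos2 phi.
  by field.
- by apply: continuous_subspaceT; exact: continuous_logkernel_dr.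
- split => [x _||]; first by apply: ex_derive.
  + by apply: cvg_at_right_filter; exact: cH.
  + by apply: cvg_at_left_filter; exact: cH.
- by move=> x _; rewrite derive1E derive_val.
Qed.

Definition logkernel r phi t : R :=
  (ln (dist2 r (t - phi)) + ln (dist2 r (t + phi))) * sin t ^+ 2.

Lemma is_derive_ln_dist2r r t : `|r| < 1 ->
  is_derive r 1 (fun r => ln (dist2 r t)) ((2 * r - 2 * cos t) / dist2 r t).
Proof.
move=> r1; have hD := dist2_gt0 t r1.
rewrite /dist2 in hD *.
have h := is_derive1_ln hD.
apply: is_derive_eq.
by rewrite /GRing.scale/=; ring.
Qed.

Lemma is_derive_logkernel r phi t : `|r| < 1 ->
  is_derive r 1 (fun r => logkernel r phi t) (logkernel_dr r phi t).
Proof.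
move=> r1.
have h1 := is_derive_ln_dist2r (t - phi) r1.
have h2 := is_derive_ln_dist2r (t + phi) r1.
rewrite /logkernel /logkernel_dr; apply: is_derive_eq.
by rewrite /GRing.scale/=; ring.
Qed.

Lemma continuous_logkernel r phi : `|r| < 1 -> continuous (logkernel r phi).
Proof.
move=> r1; apply: derivable_continuous => t.
have h1 := is_derive1_ln (dist2_gt0 (t - phi) r1).
have h2 := is_derive1_ln (dist2_gt0 (t + phi) r1).
rewrite /logkernel /dist2 in h1 h2 *.
exact: ex_derive.
Qed.

(** The bound is uniform in t and in |r| < c, as dominated differentiation in r
    asks. *)
Lemma logkernel_dr_bound c r phi t : `|r| < c -> c < 1 ->
  `|logkernel_dr r phi t| <= 8 / (1 - c) ^+ 2.
Proof.
move=> rc c1.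
have r1 : `|r| < 1 by exact: lt_trans c1.
have b x : `|(2 * r - 2 * cos x) / dist2 r x| <= 4 / (1 - c) ^+ 2.
  rewrite normrM normfV ler_pM ?invr_ge0//.
    rewrite (le_trans (ler_normB _ _))// !normrM normr_nat.
    have : `|cos x| <= 1 by rewrite ler_norml cos_geN1 cos_le1.
    by move=> ?; lra.
  rewrite gtr0_norm ?dist2_gt0//.
  rewrite lef_pV2 ?posrE ?dist2_gt0 ?exprn_gt0 ?subr_gt0//.
  apply: le_trans (dist2_ge r x).
  by rewrite ler_sqr ?nnegrE; lra.
rewrite /logkernel_dr normrM -[leRHS]mulr1 ler_pM//.
  rewrite (le_trans (ler_normD _ _))//.
  rewrite (_ : 8 / _ = 4 / (1 - c) ^+ 2 + 4 / (1 - c) ^+ 2); last first.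
    by rewrite -mulrDl -natrD.
  by rewrite lerD.
rewrite normrX -[leRHS](expr1n _ 2) ler_pXn2r ?nnegrE//.
by rewrite ler_norml sin_geN1 sin_le1.
Qed.

Lemma logkernel0 phi : logkernel 0 phi = cst 0.
Proof.
apply/funext => t.
by rewrite /logkernel /dist2 mulr0 !mul0r subr0 expr0n/= addr0 ln1 addr0 mul0r.
Qed.

(** Both sides vanish at r = 0, and differentiating under the integral sign
    shows that they have the same derivative on ]0, 1[. *)
Lemma integral_logkernel r phi : 0 <= r -> r < 1 ->
  (\int[leb]_(t in `[0%R, pi]) logkernel r phi t =
   pi / 2 * r ^+ 2 * cos (phi *+ 2))%R.
Proof.
rewrite le_eqVlt => /predU1P[<- _|r0 r1].
  by rewrite logkernel0 Rintegral_cst//= expr0n/= mulr0 !mul0r.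
pose F r := (\int[leb]_(t in `[0%R, pi]) logkernel r phi t)%R.
(* the derivative bound needs a margin: c lies strictly between r and 1 *)
pose c := (1 + r) / 2.
have [rc c1] : r < c /\ c < 1 by rewrite /c; split; lra.
have absc (x : R) : x \in `]- c, c[ -> `|x| < c by rewrite in_itv/= ltr_norml.
have abs1 (x : R) : x \in `]- c, c[ -> `|x| < 1.
  by move=> /absc xc; exact: lt_trans c1.
have dF (a : R) : a \in `]- c, c[ -> derivable F a 1 /\
    derive1 F a = (\int[leb]_(t in `[0%R, pi]) logkernel_dr a phi t)%R.
  move=> ac.
  have mB : measurable (`[0, pi]%classic : set (measurableTypeR R)) by [].
  have int (x : R) : `]-c, c[%classic x ->
      leb.-integrable `[0, pi] (EFin \o logkernel x phi).
    move=> xc.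
    apply: continuous_compact_integrable; first exact: segment_compact.
    by apply: continuous_subspaceT; apply: continuous_logkernel; exact: abs1.
  have der (x y : R) : `]-c, c[%classic x -> `[0, pi]%classic y ->
      derivable (fun r => logkernel r phi y) x 1.
    by move=> xc _; case: (is_derive_logkernel phi y (abs1 _ xc)).
  pose G (y : R) := 8 / (1 - c) ^+ 2.
  have G0 y : 0 <= G y by rewrite divr_ge0// sqr_ge0.
  have intG : leb.-integrable `[0, pi] (EFin \o G).
    apply: continuous_compact_integrable; first exact: segment_compact.
    by apply: continuous_subspaceT => ?; exact: cvg_cst.
  have pE (x y : R) : x \in `]- c, c[ ->
     partial1of2 (fun r => logkernel r phi) x y = logkernel_dr x phi y.
    move=> xc; rewrite partial1of2E.
    by have := is_derive_logkernel phi y (abs1 _ xc) => -[].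
  have Gub (x y : R) : `]-c, c[%classic x -> `[0, pi]%classic y ->
     `|partial1of2 (fun r => logkernel r phi) x y| <= G y.
    move=> xc _; rewrite pE//; apply: logkernel_dr_bound => //; exact: absc.
  split.
    exact: (@derivable_under_integral R _ _ leb (fun r => logkernel r phi)
      _ mB a _ _ ac int der G G0 intG Gub).
  have := @differentiation_under_integral R _ _ leb (fun r => logkernel r phi)
    _ mB a _ _ ac int der G G0 intG Gub.
  rewrite -/F => ->; apply: eq_Rintegral => y _; exact: pE.
pose E x := F x - pi / 2 * x ^+ 2 * cos (phi *+ 2).
have dE x : x \in `]- c, c[ ->
    is_derive x 1 E (derive1 F x - pi * x * cos (phi *+ 2)).
  move=> xc; have [dFx _] := dF x xc.
  have h : is_derive x 1 F (derive1 F x) by rewrite derive1E; exact: derivableP.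
  rewrite /E; apply: is_derive_eq.
  by rewrite /GRing.scale/=; field.
have sub x : x \in `[0, r] -> x \in `]- c, c[.
  rewrite !in_itv/= => /andP[x0 xr]; apply/andP; split.
    by rewrite (lt_le_trans _ x0)// oppr_lt0 (lt_trans r0).
  exact: le_lt_trans rc.
have E0 : E 0 = 0.
  rewrite /E expr0n/= mulr0 mul0r subr0 /F.
  by rewrite logkernel0 Rintegral_cst//= mul0r.
pose dEf x := derive1 F x - pi * x * cos (phi *+ 2).
have h1 x : x \in `]0, r[ -> is_derive x 1 E (dEf x).
  by move=> xr; apply: dE; apply: sub; exact: subset_itv_oo_cc.
have h2 : {within `[0, r], continuous E}.
  apply: derivable_within_continuous => x xr.
  by case: (dE x (sub _ xr)).
have [x] := MVT r0 h1 h2.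
rewrite /dEf.
rewrite in_itv/= => /andP[x0 xr].
have xin : x \in `]- c, c[ by apply: sub; rewrite in_itv/= !ltW.
have [_ ->] := dF x xin.
rewrite /Rintegral integral_logkernel_dr ?(lt_trans xr r1)//=.
rewrite subrr mul0r E0 subr0 => /eqP.
by rewrite /E subr_eq0 => /eqP.
Qed.

End circle_integral.

(** * Integration against the semicircle law *)

Lemma density_dominates d (T : measurableType d) (R : realType)
    (nu : {finite_measure set T -> \bar R})
    (mu : {sigma_finite_measure set T -> \bar R}) (g : T -> R) :
  measurable_fun setT g ->
  (forall A, measurable A -> nu A = (\int[mu]_(x in A) (g x)%:E)%E) ->
  nu `<< mu.
Proof.
move=> mg nuE; apply/null_content_dominatesP => A mA A0.
rewrite nuE// null_set_integral//.
exact/measurable_EFinP/measurable_funTS.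
Qed.

(** The density g agrees almost everywhere with the Radon-Nikodym derivative,
    since both have the same integrals over measurable sets. *)
Lemma ge0_integral_density d (T : measurableType d) (R : realType)
    (nu : {finite_measure set T -> \bar R})
    (mu : {sigma_finite_measure set T -> \bar R}) (g : T -> R)
    (f : T -> \bar R) (E : set T) :
  measurable_fun setT g ->
  (forall A, measurable A -> nu A = (\int[mu]_(x in A) (g x)%:E)%E) ->
  measurable E -> measurable_fun E f -> (forall x, 0 <= f x)%E ->
  (\int[nu]_(x in E) f x = \int[mu]_(x in E) (f x * (g x)%:E))%E.
Proof.
move=> mg nuE mE mf f0; have nm := density_dominates mg nuE.
have fi := Radon_Nikodym_SigmaFinite.f_integrable nm.
rewrite -(Radon_Nikodym_SigmaFinite.change_of_variables nm)//.
have mg' : measurable_fun [set: T] (EFin \o g) by exact/measurable_EFinP.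
have ae : ae_eq mu setT (Radon_Nikodym_SigmaFinite.f nu mu) (EFin \o g).
  apply: integral_ae_eq => // A _ mA.
  by rewrite -(Radon_Nikodym_SigmaFinite.f_integral nm)// nuE.
apply: ae_eq_integral => //.
- apply: emeasurable_funM => //; apply: measurable_funTS.
  exact: (measurable_int _ fi).
- by apply: emeasurable_funM => //; exact: measurable_funTS.
- case: ae => N [mN N0 sN]; exists N; split => // x /= h; apply: sN => /= h'.
  by apply: h => _; rewrite h'.
Qed.

Section semicircle.
Context {R : realType}.
Implicit Types (x l : R).
Local Notation leb := (@lebesgue_measure R).
Local Notation sc := (@semicircle_law R).

Lemma semicircle_pdfE (x : R) : -2 <= x <= 2 ->
  semicircle_pdf x = Num.sqrt (4 - x ^+ 2) / (2 * pi).
Proof.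
by move=> x2; rewrite /semicircle_pdf indicE mem_set ?mulr1//= ler_norml.
Qed.

(** Under l = 2 cos t the factor sqrt (4 - l^2) is 2 sin t, and so is minus the
    derivative of l: together they give the weight (2 / pi) sin^2 t. *)
Lemma integral_semicircle_cos (G : R -> R) :
  {within `[-2, 2], continuous G} ->
  (\int[leb]_(x in `[(-2)%R, 2%R]) (G x * semicircle_pdf x)%:E =
   \int[leb]_(t in `[0%R, pi]) (2 / pi * (G (2 * cos t) * sin t ^+ 2))%:E)%E.
Proof.
move=> cG.
pose F (t : R) := 2 * cos t.
have dF (t : R) : is_derive t 1 F (- (2 * sin t)).
  by apply: is_derive_eq; rewrite /GRing.scale/=; ring.
have F'E : derive1 F = (fun t => - (2 * sin t)).
  by apply/funext => t; rewrite derive1E derive_val.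
have cF : continuous F by apply: derivable_continuous => t; exact: ex_derive.
have cF' : continuous (fun t : R => - (2 * sin t)).
  by apply: derivable_continuous => t; exact: ex_derive.
have F0 : F 0 = 2 by rewrite /F cos0 mulr1.
have Fpi : F pi = -2 by rewrite /F cospi mulrN1.
transitivity (\int[leb]_(x in `[F pi, F 0%R])
    (G x * (Num.sqrt (4 - x ^+ 2) / (2 * pi)))%:E)%E.
  rewrite F0 Fpi; apply: eq_integral => x; rewrite inE/= in_itv/= => x2.
  by rewrite semicircle_pdfE.
rewrite integration_by_substitution_decreasing ?pi_ge0//.
- apply: eq_integral => t; rewrite inE/= in_itv/= => /andP[t0 tpi].
  congr EFin; rewrite /= !fctE F'E /F opprK.
  have s0 : 0 <= sin t by rewrite sin_ge0_pi// t0.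
  rewrite (_ : 4 - _ = (2 * sin t) ^+ 2); last first.
    have hS := sin2cos2 t.
    by ring: hS.
  rewrite sqrtr_sqr ger0_norm ?mulr_ge0//.
  rewrite [sin t ^+ 2]expr2; move: (G _) (sin t) => Gx sx.
  have : pi != 0 :> R by rewrite gt_eqF ?pi_gt0.
  by move: (pi) => P P0; field.
- move=> x y; rewrite !in_itv/= => xpi ypi xy.
  by rewrite /F ltr_pM2l// ltr_cos// in_itv.
- by rewrite F'E => x _; exact: cF'.
- by rewrite F'E; apply/cvg_ex; eexists; apply: cvg_at_right_filter; exact: cF'.
- by rewrite F'E; apply/cvg_ex; eexists; apply: cvg_at_left_filter; exact: cF'.
- split => [x _||]; first exact: ex_derive.
  + by apply: cvg_at_right_filter; exact: cF.
  + by apply: cvg_at_left_filter; exact: cF.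
- rewrite F0 Fpi => x; apply: cvgM; first exact: cG.
  apply: cvgM; last exact: cvg_cst.
  apply: continuous_subspaceT => {}x.
  apply: (@continuous_comp _ _ _ (fun x : R => 4 - x ^+ 2) Num.sqrt).
    by apply: cvgB; [exact: cvg_cst | exact: exprn_continuous].
  exact: sqrt_continuous.
Qed.

Lemma integral_sin2 :
  (\int[leb]_(t in `[0%R, pi]) (sin t ^+ 2)%:E = (pi / 2)%:E)%E.
Proof.
pose F (t : R) := (t - sin t * cos t) / 2.
have dF (t : R) : is_derive t 1 F (sin t ^+ 2).
  apply: is_derive_eq; rewrite /GRing.scale/=.
  have hS := sin2cos2 t.
  by field: hS.
have cF : continuous F by apply: derivable_continuous => t; exact: ex_derive.
have c2 : continuous (fun t : R => sin t ^+ 2).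
  by apply: derivable_continuous => t; exact: ex_derive.
rewrite (@continuous_FTC2 _ _ F) ?pi_gt0//.
- by rewrite -EFinB /F sin0 sinpi !mul0r !subr0 mul0r subr0.
- by apply: continuous_subspaceT.
- split => [x _||]; first by apply: ex_derive.
  + by apply: cvg_at_right_filter; exact: cF.
  + by apply: cvg_at_left_filter; exact: cF.
- by move=> x _; rewrite derive1E derive_val.
Qed.

Lemma semicircle_law_itv : sc `[-2, 2] = 1%E.
Proof.
rewrite /semicircle_law.
transitivity
  (\int[leb]_(x in `[(-2)%R, 2%R]) (cst 1 x * semicircle_pdf x)%:E)%E.
  by apply: eq_integral => x _; rewrite mul1r.
rewrite integral_semicircle_cos; last first.
  by apply: continuous_subspaceT => x; exact: cvg_cst.
under eq_integral do rewrite /= mul1r EFinM.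
have pi0 := @pi_gt0 R.
rewrite ge0_integralZl//.
- rewrite integral_sin2 -EFinM; congr EFin.
  by move: (pi) pi0 => P P0; field; rewrite gt_eqF.
- apply/measurable_EFinP; apply: measurable_funTS.
  apply: continuous_measurable_fun.
  by apply: derivable_continuous => t; exact: ex_derive.
- by move=> x _; rewrite lee_fin sqr_ge0.
- by rewrite lee_fin divr_ge0// ltW.
Qed.

Lemma semicircle_lawT : sc setT = 1%E.
Proof.
rewrite -semicircle_law_itv /semicircle_law [RHS]integral_mkcond.
apply: eq_integral => x _; rewrite patchE; case: ifPn => //.
rewrite notin_setE /= in_itv/= => /negP x2.
by rewrite /semicircle_pdf indicE memNset ?mulr0//= ler_norml; exact/negP.
Qed.

HB.instance Definition _ := @Measure_isProbability.Build _ _ R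
  sc semicircle_lawT.

Lemma integral_semicircle_law (f : R -> \bar R) (E : set (measurableTypeR R)) :
  measurable E -> measurable_fun E f -> (forall x, 0 <= f x)%E ->
  (\int[sc]_(x in E) f x = \int[leb]_(x in E) (f x * (semicircle_pdf x)%:E))%E.
Proof.
move=> mE mf f0.
apply: (@ge0_integral_density _ _ R sc leb semicircle_pdf) => //.
exact: measurable_semicircle_pdf.
Qed.

Lemma ge0_integral_semicircle_cos (G : R -> R) :
  {within `[-2, 2], continuous G} -> (forall l, -2 <= l <= 2 -> 0 <= G l) ->
  (\int[sc]_(x in `[(-2)%R, 2%R]) (G x)%:E =
   \int[leb]_(t in `[0%R, pi]) (2 / pi * (G (2 * cos t) * sin t ^+ 2))%:E)%E.
Proof.
move=> cG G0.
have mD : measurable (`[-2, 2]%classic : set (measurableTypeR R)) by [].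
have mG : measurable_fun (`[-2, 2]%classic : set (measurableTypeR R)) G.
  exact: subspace_continuous_measurable_fun.
(* the density formula asks for a function that is nonnegative everywhere *)
pose G' (l : R) := `|G l|.
transitivity (\int[sc]_(x in `[(-2)%R, 2%R]) (G' x)%:E)%E.
  apply: eq_integral => l; rewrite inE/= in_itv/= => l2.
  by rewrite /G' ger0_norm// G0.
rewrite integral_semicircle_law//; last 2 first.
- by apply/measurable_EFinP; apply: measurableT_comp.
- by move=> l; rewrite lee_fin normr_ge0.
rewrite -(integral_semicircle_cos cG).
apply: eq_integral => l; rewrite inE/= in_itv/= => l2.
by rewrite /G' ger0_norm ?G0.
Qed.

End semicircle.

(** * The regularized potential *)

Section regularized_potential.
Context {R : realType}.
Implicit Types (r c x l : R).
Local Notation leb := (@lebesgue_measure R).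
Local Notation sc := (@semicircle_law R).

(** The Joukowski map: it sends ]0, 1[ bijectively onto ]2, +oo[, the exterior
    of the support on the right. *)
Definition joukowski r : R := r + r^-1.

(** The product of c - 2 cos (t - phi) and c - 2 cos (t + phi) written as a
    polynomial in x = 2 cos phi and l = 2 cos t. It deforms (x - l)^2,
    obtained at c = 2, into a quantity that stays away from 0. *)
Definition regdist c x l : R := l ^+ 2 + x ^+ 2 + c ^+ 2 - 4 - c * x * l.

Lemma regdist2 x l : regdist 2 x l = `|x - l| ^+ 2.
Proof. by rewrite real_normK ?num_real// /regdist; ring. Qed.

(** At the edge x = 2 the regularization is an honest squared distance, to the
    exterior point c; this is what reduces the potential outside the support
    to the regularized one. *)
Lemma regdist_at2 c l : regdist c 2 l = `|c - l| ^+ 2.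
Proof. by rewrite real_normK ?num_real// /regdist; ring. Qed.

Lemma regdist_atN2 c l : regdist c (-2) l = `|- c - l| ^+ 2.
Proof. by rewrite real_normK ?num_real// /regdist; ring. Qed.

Lemma regdist_cos r phi t : r != 0 ->
  r ^+ 2 * regdist (joukowski r) (2 * cos phi) (2 * cos t) =
  dist2 r (t - phi) * dist2 r (t + phi).
Proof.
move=> r0; rewrite /regdist /joukowski /dist2 cosB cosD.
have hS := sin2cos2 t.
have hP := sin2cos2 phi.
by field: hS hP.
Qed.

Lemma regdist_cosE r phi t : r != 0 ->
  regdist (joukowski r) (2 * cos phi) (2 * cos t) =
  dist2 r (t - phi) * dist2 r (t + phi) / r ^+ 2.
Proof.
by move=> r0; rewrite -regdist_cos// [RHS]mulrAC mulfV ?mul1r// expf_neq0.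
Qed.

Lemma cos_surj x : -2 <= x <= 2 -> exists t, x = 2 * cos t.
Proof.
move=> x2; exists (acos (x / 2)); rewrite acosK; first by field.
by rewrite in_itv/=; lra.
Qed.

Lemma regdist_gt0 r x l : 0 < r -> r < 1 -> -2 <= x <= 2 -> -2 <= l <= 2 ->
  0 < regdist (joukowski r) x l.
Proof.
move=> r0 r1 /cos_surj[phi ->] /cos_surj[t ->].
rewrite regdist_cosE ?gt_eqF// divr_gt0 ?exprn_gt0//.
by rewrite mulr_gt0// dist2_gt0 ?gtr0_norm.
Qed.

Lemma continuous_ln_regdist r x : 0 < r -> r < 1 -> -2 <= x <= 2 ->
  {within `[-2, 2], continuous (fun l => ln (regdist (joukowski r) x l))}.
Proof.
move=> r0 r1 x2; apply: derivable_within_continuous => l.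
rewrite in_itv/= => l2.
have h := is_derive1_ln (regdist_gt0 r0 r1 x2 l2).
rewrite /regdist in h *.
exact: ex_derive.
Qed.

Definition potential_val r x : R := r ^+ 2 * (x ^+ 2 / 2 - 1) / 2 - ln r.

(** The integrand is shifted by the upper bound (ln M) / 2 to make it
    nonnegative; then the monotone limit r -> 1 can be taken later without
    knowing in advance that the logarithm is integrable. *)
Lemma integral_ln_regdist r x M : 0 < r -> r < 1 -> -2 <= x <= 2 ->
  (forall l, -2 <= l <= 2 -> regdist (joukowski r) x l <= M) ->
  (\int[sc]_(l in `[(-2)%R, 2%R])
     ((ln M - ln (regdist (joukowski r) x l)) / 2)%:E =
   (ln M / 2 - potential_val r x)%:E)%E.
Proof.
move=> r0 r1 x2 hM.
have nr1 : `|r| < 1 by rewrite gtr0_norm.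
have rn0 : r != 0 by rewrite gt_eqF.
rewrite (@ge0_integral_semicircle_cos R
  (fun l => (ln M - ln (regdist (joukowski r) x l)) / 2)); last 2 first.
- move=> l; apply: cvgM; last exact: cvg_cst.
  by apply: cvgB; [exact: cvg_cst|exact: continuous_ln_regdist].
- move=> l l2; have R0 := regdist_gt0 r0 r1 x2 l2.
  by rewrite divr_ge0// subr_ge0 ler_ln ?posrE ?hM// (lt_le_trans R0)// hM.
have [phi xE] := cos_surj x2.
pose k : R := (ln M + 2 * ln r) / pi.
transitivity (\int[leb]_(t in `[0%R, pi])
    ((k * sin t ^+ 2)%:E - (pi^-1 * logkernel r phi t)%:E))%E.
  apply: eq_integral => t _; rewrite -EFinB; congr EFin.
  rewrite xE regdist_cosE//.
  rewrite lnM ?posrE ?invr_gt0 ?exprn_gt0 ?mulr_gt0 ?dist2_gt0//.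
  rewrite lnM ?posrE ?dist2_gt0// lnV ?posrE ?exprn_gt0// lnXn//.
  rewrite /k /logkernel.
  have : pi != 0 :> R by rewrite gt_eqF ?pi_gt0.
  by move: (pi) => P P0; field.
have int1 : leb.-integrable `[0, pi] (fun t => (k * sin t ^+ 2)%:E).
  apply: continuous_compact_integrable; first exact: segment_compact.
  apply: continuous_subspaceT; apply: derivable_continuous => t.
  exact: ex_derive.
have int2 : leb.-integrable `[0, pi] (fun t => (logkernel r phi t)%:E).
  apply: continuous_compact_integrable; first exact: segment_compact.
  by apply: continuous_subspaceT; exact: continuous_logkernel.
have int3 : leb.-integrable `[0, pi] (fun t => (sin t ^+ 2)%:E).
  apply: continuous_compact_integrable; first exact: segment_compact.
  apply: continuous_subspaceT; apply: derivable_continuous => t.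
  exact: ex_derive.
have int2' : leb.-integrable `[0, pi] (fun t => (pi^-1 * logkernel r phi t)%:E).
  rewrite (_ : (fun t => _) = (fun t => (pi^-1)%:E * (logkernel r phi t)%:E)%E).
    exact: integrableZl.
  by apply/funext => t; rewrite EFinM.
rewrite integralB//.
under eq_integral do rewrite EFinM.
rewrite integralZl// integral_sin2.
under [X in (_ - X)%E]eq_integral do rewrite EFinM.
rewrite integralZl//.
have IL := integral_logkernel phi (ltW r0) r1.
have fin : (\int[leb]_(t in `[0%R, pi]) (logkernel r phi t)%:E)%E \is a fin_num.
  exact: integrable_fin_num.
rewrite -(fineK fin) [fine _]IL -!EFinM -EFinB; congr EFin.
rewrite /k /potential_val xE mulr2n cosD.
have hP := sin2cos2 phi.
have : pi != 0 :> R by rewrite gt_eqF ?pi_gt0.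
by move: (pi) => P P0; field: hP.
Qed.

End regularized_potential.

(** * The logarithmic potential of the semicircle law *)

Section logarithmic_potential.
Context {R : realType}.
Implicit Types (r c x l : R).
Local Notation leb := (@lebesgue_measure R).
Local Notation sc := (@semicircle_law R).

Lemma measurable_ln_dist x (E : set (measurableTypeR R)) :
  measurable_fun E (fun l : measurableTypeR R => ln `|x - l|).
Proof.
apply: measurable_funTS; apply: measurableT_comp => //.
apply: measurableT_comp => //.
by apply: measurable_funB.
Qed.

(** Recovers the real integral of a function bounded above from the extended
    integral of its nonnegative complement; integrability comes for free, as
    that integral is finite. *)
Lemma Rintegral_semicircle_bounded (g : R -> R) (k v : R) :
  measurable_fun (`[-2, 2]%classic : set (measurableTypeR R)) g ->
  (forall l, -2 <= l <= 2 -> g l <= k) ->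
  (\int[sc]_(l in `[(-2)%R, 2%R]) (k - g l)%:E = (k - v)%:E)%E ->
  (\int[sc]_(l in `[(-2)%R, 2%R]) g l)%R = v.
Proof.
move=> mg gk kE.
have mD : measurable (`[-2, 2]%classic : set (measurableTypeR R)) by [].
have scD : sc `[-2, 2] = 1%E := semicircle_law_itv.
have ik : sc.-integrable `[-2, 2] (EFin \o (fun l => k - g l)).
  apply/integrableP; split.
    by apply/measurable_EFinP; apply: measurable_funB.
  rewrite (_ : integral _ _ _ = (k - v)%:E) ?ltry// -kE.
  apply: eq_integral => l; rewrite inE/= in_itv/= => l2.
  by rewrite ger0_norm// subr_ge0 gk.
have ic : sc.-integrable `[-2, 2] (EFin \o (fun=> k)).
  by apply/finite_measure_integrable_cst.
transitivity (\int[sc]_(l in `[(-2)%R, 2%R]) (k - (k - g l)))%R.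
  by apply: eq_Rintegral => l _; ring.
rewrite RintegralB// Rintegral_cst//.
rewrite /Rintegral kE [X in k * fine X]scD /=; ring.
Qed.

(** The cases x = 2 and x = -2 give the exterior points to the right and to
    the left of the support. *)
Lemma Omega_joukowski r x : 0 < r -> r < 1 -> (x == 2) || (x == -2) ->
  Omega (x / 2 * joukowski r) = r ^+ 2 / 2 - ln r.
Proof.
move=> r0 r1 x2; have x2' : -2 <= x <= 2 by case/orP: x2 => /eqP ->; lra.
set c := joukowski r.
have c2 : 2 < c.
  rewrite -subr_gt0 (_ : _ - _ = (1 - r) ^+ 2 / r); last first.
    by rewrite /c /joukowski; field; rewrite gt_eqF.
  by rewrite divr_gt0// exprn_gt0// subr_gt0.
have RE l : regdist c x l = `|x / 2 * c - l| ^+ 2.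
  case/orP: x2 => /eqP ->; first by rewrite regdist_at2 mulfV ?mul1r.
  by rewrite regdist_atN2 mulNr mulfV// mulN1r.
have ubR l : -2 <= l <= 2 -> regdist c x l <= (c + 2) ^+ 2.
  move=> l2; rewrite RE ler_sqr ?nnegrE//; last by lra.
  have xc : `|x / 2 * c| = c.
    case/orP: x2 => /eqP ->; rewrite ?mulNr ?normrN mulfV// mul1r gtr0_norm//;
      by lra.
  rewrite (le_trans (ler_normB _ _))// xc lerD2l.
  by rewrite ler_norml.
have lnE l : -2 <= l <= 2 -> ln `|x / 2 * c - l| = ln (regdist c x l) / 2.
  move=> l2; have := regdist_gt0 r0 r1 x2' l2.
  rewrite -/c RE => h; rewrite lnXn; first by field.
  rewrite lt_def normr_ge0 andbT; apply: contraTneq h => ->.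
  by rewrite expr0n ltxx.
apply: (@Rintegral_semicircle_bounded _ (ln ((c + 2) ^+ 2) / 2)).
- exact: measurable_ln_dist.
- move=> l l2; rewrite lnE// ler_pM2r// ler_ln ?posrE ?ubR// ?regdist_gt0//.
  by rewrite exprn_gt0//; lra.
- transitivity (ln ((c + 2) ^+ 2) / 2 - potential_val r x)%:E.
    rewrite -(integral_ln_regdist r0 r1 x2' ubR).
    apply: eq_integral => l; rewrite inE/= in_itv/= => l2.
    by rewrite lnE// mulrBl.
  congr (_ - _)%:E; rewrite /potential_val.
  by case/orP: x2 => /eqP ->; field.
Qed.

Lemma semicircle_law_set1 x : sc [set x] = 0%E.
Proof. by rewrite /semicircle_law integral_set1. Qed.

(** An increasing sequence of radii in [1/2, 1[ tending to 1. *)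
Definition radius (n : nat) : R := 1 - n.+2%:R^-1.

Lemma radius_itv n : 1 / 2 <= radius n < 1.
Proof.
rewrite /radius ltrBlDr ltrDl invr_gt0 ltr0n andbT.
rewrite [1 / 2](_ : _ = 1 - 2^-1); last by field.
by rewrite lerB// lef_pV2 ?posrE ?ltr0n// ler_nat.
Qed.

Lemma cvg_radius : radius n @[n --> \oo] --> (1 : R).
Proof.
rewrite -[X in _ --> X]subr0; apply: cvgB; first exact: cvg_cst.
apply: (@cvg_comp _ _ _ S (@harmonic R)); last exact: cvg_harmonic.
exact: (cvg_addnl 1).
Qed.

Lemma le_radius m n : (m <= n)%N -> radius m <= radius n.
Proof.
by move=> mn; rewrite lerB// lef_pV2 ?posrE ?ltr0n// ler_nat.
Qed.

Lemma joukowski_anti r s : 0 < r -> r <= s -> s <= 1 ->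
  joukowski s <= joukowski r.
Proof.
move=> r0 rs s1; have s0 : 0 < s by exact: lt_le_trans rs.
rewrite -subr_ge0 (_ : _ - _ = (s - r) * (1 - r * s) / (r * s)); last first.
  by rewrite /joukowski; field; rewrite !gt_eqF.
apply: divr_ge0; last by rewrite ltW// mulr_gt0.
apply: mulr_ge0; rewrite subr_ge0//.
by apply: mulr_ile1 => //; [exact: ltW|exact: ltW|exact: le_trans rs _].
Qed.

Lemma joukowski_ge2 r : 0 < r -> 2 <= joukowski r.
Proof.
move=> r0; rewrite -subr_ge0 (_ : _ - _ = (1 - r) ^+ 2 / r); last first.
  by rewrite /joukowski; field; rewrite gt_eqF.
by rewrite divr_ge0 ?sqr_ge0// ltW.
Qed.

(** The difference factors as (c' - c)(c' + c - x l), and x l <= 4. *)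
Lemma regdist_mono c c' x l : 2 <= c -> c <= c' ->
  -2 <= x <= 2 -> -2 <= l <= 2 ->
  regdist c x l <= regdist c' x l.
Proof.
move=> c2 cc /andP[? ?] /andP[? ?]; rewrite -subr_ge0.
rewrite (_ : _ - _ = (c' - c) * (c' + c - x * l)); last first.
  by rewrite /regdist; ring.
rewrite mulr_ge0 ?subr_ge0//; nra.
Qed.

(** Monotone convergence along the radii tending to 1. The point l = x, where
    the limit of the integrands is infinite, is removed first: the semicircle
    law does not charge it. *)
Lemma Omega_bulk x : -2 <= x <= 2 -> Omega x = x ^+ 2 / 4 - 1 / 2.
Proof.
move=> x2.
have r0 n : 0 < radius n by have /andP[? _] := radius_itv n; lra.
have r1 n : radius n < 1 by have /andP[_] := radius_itv n.
pose c n := joukowski (radius n).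
have c2 n : 2 <= c n by exact: joukowski_ge2.
have c52 n : c n <= 5 / 2.
  rewrite (_ : 5 / 2 = joukowski (1 / 2)); last by rewrite /joukowski; field.
  by apply: joukowski_anti; [lra|have /andP[] := radius_itv n|exact: ltW].
(* crude bound on [-2, 2]: 4 + 4 + 25/4 - 4 + 10 is less than 21 *)
have ubR n l : -2 <= l <= 2 -> regdist (c n) x l <= 21.
  move=> l2; apply: le_trans (regdist_mono (c2 n) (c52 n) x2 l2) _.
  by rewrite /regdist; case/andP: x2 => ? ?; case/andP: l2 => ? ?; nra.
have R0 n l : -2 <= l <= 2 -> 0 < regdist (c n) x l.
  by move=> l2; exact: regdist_gt0.
have Rlim l : regdist (c n) x l @[n --> \oo] --> `|x - l| ^+ 2.
  rewrite -regdist2.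
  have cc : c n @[n --> \oo] --> (2 : R).
    rewrite (_ : 2 = 1 + 1^-1); last by rewrite invr1.
    apply: cvgD; first exact: cvg_radius.
    by apply: cvgV; [exact: oner_neq0|exact: cvg_radius].
  apply: (@continuous_cvg _ _ _ _ _ _ (fun c => regdist c x l)) => //.
  apply: derivable_continuous => t; rewrite /regdist; exact: ex_derive.
have distE l : l != x -> ln `|x - l| = ln (`|x - l| ^+ 2) / 2.
  move=> lx; rewrite lnXn; first by field.
  by rewrite normr_gt0 subr_eq0 eq_sym.
have ub l : -2 <= l <= 2 -> ln `|x - l| <= ln 21 / 2.
  have h21 : 0 <= ln (21 : R) by rewrite ln_ge0; lra.
  have [->|lx] := eqVneq l x; first by rewrite subrr normr0 ln0// divr_ge0.
  move=> l2; rewrite distE// ler_pM2r//.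
  rewrite ler_ln ?posrE ?exprn_gt0 ?normr_gt0 ?subr_eq0 1?eq_sym//.
  rewrite real_normK ?num_real//.
  by case/andP: x2 => ? ?; case/andP: l2 => ? ?; nra.
apply: (@Rintegral_semicircle_bounded _ (ln 21 / 2)) => //.
  exact: measurable_ln_dist.
pose f n l : \bar R := ((ln 21 - ln (regdist (c n) x l)) / 2)%:E.
have mD : measurable (`[-2, 2]%classic : set (measurableTypeR R)) by [].
have m1 : measurable ([set x] : set (measurableTypeR R)) by [].
have f0 n l : `[-2, 2]%classic l -> (0 <= f n l)%E.
  rewrite /= in_itv/= => l2.
  by rewrite lee_fin divr_ge0// subr_ge0 ler_ln ?posrE ?ubR ?R0.
have mf n : measurable_fun (`[-2, 2]%classic : set (measurableTypeR R)) (f n).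
  apply/measurable_EFinP.
  apply: measurable_funM => //; apply: measurable_funB => //.
  apply: subspace_continuous_measurable_fun => //.
  exact: continuous_ln_regdist.
have If n : (\int[sc]_(l in `[(-2)%R, 2%R] `\` [set x]) f n l =
    (ln 21 / 2 - potential_val (radius n) x)%:E)%E.
  rewrite -(@ge0_negligible_integral _ _ R sc _ _ _ m1 mD (mf n) (f0 n)
    (semicircle_law_set1 x)).
  by apply: integral_ln_regdist => // l; exact: ubR.
rewrite (@ge0_negligible_integral _ _ R sc _ _ _ m1 mD); last 3 first.
- apply/measurable_EFinP; apply: measurable_funB => //.
  exact: measurable_ln_dist.
- by move=> l; rewrite /= in_itv/= => l2; rewrite lee_fin subr_ge0 ub.
- exact: semicircle_law_set1.
have mDx :
    measurable ((`[-2, 2] `\` [set x])%classic : set (measurableTypeR R)).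
  exact: measurableD.
have mfx n :
    measurable_fun (`[-2, 2] `\` [set x] : set (measurableTypeR R)) (f n).
  by apply: measurable_funS (mf n) => // l [].
have f0x n l : (`[-2, 2]%classic `\` [set x]) l -> (0 <= f n l)%E.
  by case=> l2 _; exact: f0.
have ndf l : (`[-2, 2]%classic `\` [set x]) l ->
    {homo f^~ l : n m / (n <= m)%N >-> (n <= m)%E}.
  move=> [/=]; rewrite in_itv/= => l2 _ m n mn.
  rewrite lee_fin ler_pM2r// lerB// ler_ln ?posrE ?R0//.
  apply: regdist_mono => //.
  by apply: joukowski_anti; [exact: r0|exact: le_radius|exact: ltW].
have h := @cvg_monotone_convergence _ _ R sc _ mDx f mfx f0x ndf.
transitivity (\int[sc]_(l in `[(-2)%R, 2%R] `\` [set x]) limn (f^~ l))%E.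
  apply: eq_integral => l; rewrite inE => -[/=].
  rewrite in_itv/= => l2 /eqP lx; apply/esym/cvg_lim => //.
  apply/fine_cvgP; split; first exact: nearW.
  rewrite distE// -mulrBl; apply: cvgM; last exact: cvg_cst.
  apply: cvgB; first exact: cvg_cst.
  apply: (continuous_cvg _ _ (Rlim l)); apply: continuous_ln.
  by rewrite exprn_gt0// normr_gt0 subr_eq0 eq_sym.
have {}h := cvg_trans (near_eq_cvg (nearW _ If)) h.
suff h2 : (ln 21 / 2 - potential_val (radius n) x)%:E @[n --> \oo] -->
    (ln 21 / 2 - (x ^+ 2 / 4 - 1 / 2))%:E.
  exact: (cvg_unique (@ereal_hausdorff R) (h _ _) h2).
apply/fine_cvgP; split; first exact: nearW.
apply: cvgB; first exact: cvg_cst.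
rewrite (_ : x ^+ 2 / 4 - 1 / 2 = potential_val 1 x); last first.
  by rewrite /potential_val ln1; field.
rewrite /potential_val; apply: cvgB; last first.
  by apply: continuous_cvg; [exact: continuous_ln|exact: cvg_radius].
do 2 (apply: cvgM; last exact: cvg_cst).
apply: (@continuous_cvg _ _ _ _ _ _ (fun r : R => r ^+ 2)).
  exact: exprn_continuous.
exact: cvg_radius.
Qed.

End logarithmic_potential.

(** * Parabolas above the potential *)

Section envelope.
Context {R : realType}.
Implicit Types (q r x y z : R).

(** Concavity of the potential as a function of x^2, in the coordinate q with
    x^2 = (q + 1)^2 / q. The difference of the two sides has derivative
    (q - 1)(q - z) / (q^2 (z + 1)) in q, so it is smallest at q = z, where it
    vanishes. *)
Lemma ln_sub_le q z : 1 <= q -> 1 <= z ->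
  ln q - ln z <= (q + 1) * (q - z) / (q * (z + 1)).
Proof.
move=> q1 z1.
pose f (t : R) := (t + 1) * (t - z) / (t * (z + 1)) - ln t.
pose df (t : R) := (t - 1) * (t - z) / (t ^+ 2 * (z + 1)).
have dfE (t : R) : 1 <= t -> is_derive t 1 f (df t).
  move=> t1; have t0 : 0 < t by exact: lt_le_trans t1.
  have h := is_derive1_ln t0.
  have tz : t * (z + 1) != 0 by rewrite gt_eqF// mulr_gt0//; lra.
  apply: is_derive_eq; rewrite /GRing.scale/= /df.
  by field; rewrite !gt_eqF//; lra.
have cf (a b : R) : 1 <= a -> {within `[a, b], continuous f}.
  move=> a1; apply: derivable_within_continuous => t.
  rewrite in_itv/= => /andP[at_ _].
  by case: (dfE t (le_trans a1 at_)).
have fz : f z = - ln z by rewrite /f subrr mulr0 mul0r sub0r.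
suff : f z <= f q by rewrite fz /f; lra.
have dfo (a b t : R) : 1 <= a -> t \in `]a, b[ -> is_derive t 1 f (df t).
  move=> a1; rewrite in_itv/= => /andP[at_ _].
  by apply: dfE; rewrite (le_trans a1)// ltW.
have pos (t : R) : 1 < t -> 0 <= (t - 1) / (t ^+ 2 * (z + 1)).
  by move=> t1; rewrite divr_ge0 ?subr_ge0 ?mulr_ge0 ?sqr_ge0//; lra.
have dfE' (t : R) : df t = (t - 1) / (t ^+ 2 * (z + 1)) * (t - z).
  by rewrite /df mulrAC.
have [zq|qz|->//] := ltgtP z q.
- have [t] := MVT zq (fun t => @dfo _ _ t z1) (cf z q z1).
  rewrite in_itv/= => /andP[zt tq] e.
  rewrite -subr_ge0 e dfE' mulr_ge0 ?subr_ge0 ?(ltW zq)//.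
  rewrite mulr_ge0 ?subr_ge0 ?(ltW zt)//.
  by apply: pos; exact: le_lt_trans zt.
- have [t] := MVT qz (fun t => @dfo _ _ t q1) (cf q z q1).
  rewrite in_itv/= => /andP[qt tz] e.
  rewrite -subr_le0 e dfE' mulr_le0_ge0 ?subr_ge0 ?(ltW qz)//.
  rewrite mulr_ge0_le0 ?subr_le0 ?(ltW tz)//.
  by apply: pos; exact: le_lt_trans qt.
Qed.

Lemma joukowski_inv y : 2 < y -> exists r, [/\ 0 < r, r < 1 & y = joukowski r].
Proof.
move=> y2; pose d := Num.sqrt (y ^+ 2 - 4).
have d2 : d ^+ 2 = y ^+ 2 - 4 by rewrite sqr_sqrtr// subr_ge0; nra.
have d0 : 0 <= d by exact: sqrtr_ge0.
have dy : d < y by rewrite -(@ltr_pXn2r _ 2) ?nnegrE//; lra.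
have r1 : (y - d) / 2 < 1 by nra.
exists ((y - d) / 2); split => //; first by lra.
by rewrite /joukowski; field: d2; rewrite subr_eq0 gt_eqF.
Qed.

(** As a function of x^2, the tangent line to the potential at the point
    x = sqrt z + 1 / sqrt z. *)
Definition Omega_env z x : R := x ^+ 2 / (2 * (z + 1)) + ln z / 2 - 1 / 2.

(** Inside the support the parametrization degenerates and the tangency
    inequality is used at q = 1; outside, q = 1 / r^2 for |x| = r + 1/r. *)
Lemma Omega_le z x : 1 <= z -> Omega x <= Omega_env z x.
Proof.
rewrite /Omega_env => z1; have z10 : z + 1 != 0 by rewrite gt_eqF//; lra.
have [x2|x2] := lerP `|x| 2.
  rewrite Omega_bulk; last by rewrite -ler_norml.
  have := ln_sub_le (lexx 1) z1.
  rewrite ln1 sub0r mul1r => h.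
  have xx : x ^+ 2 <= 4.
    by move: x2; rewrite ler_norml => /andP[? ?]; nra.
  have : 0 <= (4 - x ^+ 2) * (z - 1) / (4 * (z + 1)).
    by rewrite divr_ge0 ?mulr_ge0 ?subr_ge0//; lra.
  rewrite (_ : _ / _ = - ((1 + 1) * (1 - z) / (z + 1)) / 2
       + (x ^+ 2 / (2 * (z + 1)) - x ^+ 2 / 4)); last by field.
  lra.
have [r [r0 r1 xr]] := joukowski_inv x2.
have rn0 : r != 0 by rewrite gt_eqF.
have OE : Omega x = r ^+ 2 / 2 - ln r.
  have : x = 2 / 2 * joukowski r \/ x = - 2 / 2 * joukowski r.
    rewrite -xr mulNr mulfV// mul1r mulN1r.
    by case: (ger0P x) => _; [left|right; rewrite opprK].
  by case=> ->; rewrite Omega_joukowski// eqxx ?orbT.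
pose q := r ^- 2.
have q1 : 1 <= q.
  by rewrite /q invf_ge1 ?exprn_gt0// exprn_ile1// ltW.
have lnq : ln q = - (2 * ln r).
  by rewrite /q lnV ?posrE ?exprn_gt0// lnXn// mulr_natl.
have x2E : x ^+ 2 = (r + r^-1) ^+ 2 by rewrite -real_normK ?num_real// xr.
have := ln_sub_le q1 z1; rewrite lnq OE x2E.
rewrite (_ : (q + 1) * (q - z) / (q * (z + 1)) =
   2 * ((r + r^-1) ^+ 2 / (2 * (z + 1)) - 1 / 2 - r ^+ 2 / 2)); last first.
  by rewrite /q; field; rewrite rn0 z10.
lra.
Qed.

(** The strict inequality of arithmetic and geometric means for n copies of r
    and one copy of 1 + n (1 - r), whose mean is 1. The left side is
    nonincreasing in n: consecutive values differ by (n + 1) r^n (1 - r)^2. *)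
Lemma amgm_lt n r : (0 < n)%N -> 0 <= r -> r != 1 ->
  r ^+ n * (1 + n%:R * (1 - r)) < 1.
Proof.
case: n => // n _ r0 r1.
have pos : 0 < (1 - r) ^+ 2 by rewrite exprn_even_gt0//= subr_eq0 eq_sym.
elim: n => [|n]; first by rewrite expr1; nra.
apply: le_lt_trans; rewrite -subr_ge0.
rewrite (_ : _ - _ = n.+2%:R * r ^+ n.+1 * (1 - r) ^+ 2); last first.
  by rewrite !exprS -!natr1; ring.
by rewrite mulr_ge0 ?(ltW pos)// mulr_ge0 ?exprn_ge0.
Qed.

End envelope.

(** * The supremum over the energy *)

Section energy_sup.
Context {R : realType}.
Implicit Types (r s z beta u : R) (n : nat).

(** In this part p = n + 2 with n > 0, so that no truncated subtraction is
    left. *)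
Lemma natS2 n : n.+2%:R = n%:R + 2 :> R. Proof. by rewrite -!natr1; ring. Qed.

Lemma s_starE n : s_star n.+2 = n%:R / (n%:R + 1) :> R.
Proof. by rewrite /s_star natS2; congr (_ / _); ring. Qed.

Lemma beta_sh_sqr n : beta_sh n.+2 ^+ 2 =
  (n%:R + 1) ^+ n.+1 / ((n%:R + 2) * n%:R ^+ n) :> R.
Proof.
rewrite /beta_sh natS2 subn1 subn2/=.
rewrite (_ : n%:R + 2 - 1 = n%:R + 1 :> R); last by ring.
rewrite (_ : n%:R + 2 - 2 = n%:R :> R); last by ring.
by rewrite sqr_sqrtr// divr_ge0 ?mulr_ge0 ?exprn_ge0 ?addr_ge0.
Qed.

Lemma le_beta_sh_sqr n beta : (0 < n)%N -> 0 < beta -> beta <= beta_sh n.+2 ->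
  beta ^+ 2 * (n%:R + 2) * n%:R ^+ n <= (n%:R + 1) ^+ n.+1.
Proof.
move=> n0 b0 bb; have N0 : 0 < n%:R :> R by rewrite ltr0n.
have : beta ^+ 2 <= beta_sh n.+2 ^+ 2.
  by rewrite ler_sqr ?nnegrE ?sqrtr_ge0// ltW.
by rewrite beta_sh_sqr -mulrA ler_pdivlMr// mulr_gt0 ?exprn_gt0// addr_gt0.
Qed.

(** Replacing Omega by the parabola of parameter z in Phi leaves, up to terms
    constant in the energy u, the quadratic - curv u^2 / 2 + tilt u, which is
    maximal at u = tilt / curv. *)
Definition curv n z : R := ((n%:R + 1) * z - 1) / ((n%:R + 1) * (z + 1)).

Definition tilt n beta s : R := beta * Num.sqrt s ^+ n.+2.

(** The maximum over u of that quadratic bound for Phi, minus beta^2 / 2. *)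
Definition crest n beta s z : R :=
  (ln ((n%:R + 1) * (1 - s)) + ln z) / 2 +
  beta ^+ 2 * s ^+ n.+1 / 2 *
   (s * (n%:R + 1) * (z + 1) / ((n%:R + 1) * z - 1) - s - (n%:R + 2) * (1 - s)).

Lemma curv_gt0 n z : (0 < n)%N -> 1 <= z -> 0 < curv n z.
Proof.
move=> n0 z1; have N0 : 1 <= n%:R :> R by rewrite ler1n.
rewrite /curv divr_gt0//; nra.
Qed.

Lemma sqr_tilt n beta s : 0 <= s -> tilt n beta s ^+ 2 = beta ^+ 2 * s ^+ n.+2.
Proof. by move=> s0; rewrite /tilt exprMn exprAC sqr_sqrtr. Qed.

Lemma scale_sqr n : Num.sqrt (n.+2%:R / (n.+2%:R - 1)) ^+ 2 =
  (n%:R + 2) / (n%:R + 1) :> R.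
Proof.
rewrite natS2 (_ : n%:R + 2 - 1 = n%:R + 1); last by ring.
by rewrite sqr_sqrtr// divr_ge0// addr_ge0.
Qed.

(** Completing the square in u. *)
Lemma Phi_env n beta u s z : (0 < n)%N -> 1 <= z -> 0 <= s -> s < 1 ->
  Phi n.+2 beta u (Num.sqrt s) - beta ^+ 2 / 2 =
  crest n beta s z - curv n z / 2 * (u - tilt n beta s / curv n z) ^+ 2
  + (Omega (Num.sqrt (n.+2%:R / (n.+2%:R - 1)) * u)
     - Omega_env z (Num.sqrt (n.+2%:R / (n.+2%:R - 1)) * u)).
Proof.
move=> n0 z1 s0 s1.
have N0 : 1 <= n%:R :> R by rewrite ler1n.
rewrite /Omega_env exprMn scale_sqr /Phi /Sigma.
move: (Omega _) => W.
rewrite -/(tilt n beta s) sqr_sqrtr// /v.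
rewrite sqr_sqrtr// (_ : Num.sqrt s ^+ (2 * n.+2) = s ^+ n.+2); last first.
  by rewrite exprM sqr_sqrtr.
rewrite (_ : Num.sqrt s ^+ (2 * n.+2 - 2) = s ^+ n.+1); last first.
  by rewrite (_ : (2 * n.+2 - 2 = 2 * n.+1)%N) ?exprM ?sqr_sqrtr// !mulnS addKn.
have N1 : 0 < n%:R + 1 :> R by lra.
rewrite /crest [in RHS]lnM ?posrE ?subr_gt0//.
have k0 := curv_gt0 n0 z1.
have -> : curv n z / 2 * (u - tilt n beta s / curv n z) ^+ 2 =
    curv n z / 2 * u ^+ 2 - tilt n beta s * u +
    beta ^+ 2 * s ^+ n.+2 / (2 * curv n z).
  by rewrite -sqr_tilt//; field; rewrite gt_eqF.
rewrite natS2 /curv (_ : n%:R + 2 - 1 = n%:R + 1 :> R); last by ring.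
rewrite [s ^+ n.+2]exprS.
move: (s ^+ n.+1) (ln _) (ln _) (ln _) => S l1 l2 l3.
move: (tilt _ _ _) => T; move: (n%:R) N0 N1 {k0} => N N0 N1.
field.
by rewrite !gt_eqF//; nra.
Qed.

Lemma Phi_le n beta u s z : (0 < n)%N -> 1 <= z -> 0 <= s -> s < 1 ->
  Phi n.+2 beta u (Num.sqrt s) - beta ^+ 2 / 2 <=
  crest n beta s z - curv n z / 2 * (u - tilt n beta s / curv n z) ^+ 2.
Proof.
move=> n0 z1 s0 s1; rewrite (Phi_env beta u n0 z1)// gerDl subr_le0.
exact: Omega_le.
Qed.

Lemma Phi_eq n beta u s : (0 < n)%N -> 0 <= s -> s < 1 ->
  (n%:R + 2) * u ^+ 2 <= 4 * (n%:R + 1) ->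
  Phi n.+2 beta u (Num.sqrt s) - beta ^+ 2 / 2 =
  crest n beta s 1 - curv n 1 / 2 * (u - tilt n beta s / curv n 1) ^+ 2.
Proof.
move=> n0 s0 s1 hu; rewrite (Phi_env beta u n0 (lexx 1))//.
rewrite Omega_bulk; last first.
  rewrite -ler_norml -(@ler_pXn2r _ 2) ?nnegrE// real_normK ?num_real//.
  rewrite exprMn scale_sqr mulrAC ler_pdivrMr ?ltr_wpDl//.
  by apply: le_trans hu _; rewrite expr2; lra.
by rewrite [X in _ + X](_ : _ = 0) ?addr0// /Omega_env ln1; field.
Qed.

Lemma crest1E n beta s : (0 < n)%N -> s < 1 ->
  crest n beta s 1 = ln ((n%:R + 1) * (1 - s)) / 2 +
   beta ^+ 2 * (n%:R + 2) * s ^+ n.+1 * (s * (n%:R + 1) / n%:R - 1) / 2.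
Proof.
move=> n0 s1; have N0 : 0 < n%:R :> R by rewrite ltr0n.
rewrite /crest ln1 addr0; congr (_ + _).
by field; rewrite ?gt_eqF//; lra.
Qed.

(** The bulk condition |x| <= 2 at the vertex of the quadratic. The left side
    increases with s and with beta, and equality holds at s = s_* and
    beta = beta_sh. *)
Lemma tilt_bulk n beta s : (0 < n)%N -> 0 < beta -> beta <= beta_sh n.+2 ->
  0 <= s -> s <= s_star n.+2 ->
  (n%:R + 2) * (tilt n beta s / curv n 1) ^+ 2 <= 4 * (n%:R + 1).
Proof.
move=> n0 b0 bb s0; rewrite s_starE => ss.
have N0 : 0 < n%:R :> R by rewrite ltr0n.
have N1 : 0 < n%:R + 1 :> R by lra.
have hb := le_beta_sh_sqr n0 b0 bb.
have hs : s ^+ n.+2 <= (n%:R / (n%:R + 1)) ^+ n.+2.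
  by rewrite ler_pXn2r// ?nnegrE// divr_ge0// ltW.
rewrite expr_div_n sqr_tilt//.
have -> : (n%:R + 2) * (beta ^+ 2 * s ^+ n.+2 / curv n 1 ^+ 2) =
    4 * (n%:R + 1) ^+ 2 / n%:R ^+ 2 * (beta ^+ 2 * (n%:R + 2) * s ^+ n.+2).
  rewrite /curv; field.
  by rewrite ?gt_eqF//; lra.
apply: (@le_trans _ _ (4 * (n%:R + 1) ^+ 2 / n%:R ^+ 2 *
   ((n%:R + 1) ^+ n.+1 / n%:R ^+ n * (n%:R / (n%:R + 1)) ^+ n.+2))).
  rewrite ler_pM2l ?divr_gt0 ?mulr_gt0 ?exprn_gt0//.
  apply: ler_pM => //; last first.
  - by rewrite ler_pdivlMr ?exprn_gt0.
  - by rewrite exprn_ge0.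
  - by rewrite !mulr_ge0 ?sqr_ge0//; lra.
rewrite expr_div_n ![_ ^+ n.+2]exprS ![_ ^+ n.+1]exprS.
have := exprn_gt0 n N0; have := exprn_gt0 n N1.
move: (_ ^+ n) (_ ^+ n) => A B A0 B0.
rewrite le_eqVlt; apply/orP; left; apply/eqP; field.
by rewrite !gt_eqF.
Qed.

(** With r = s / s_*, the function s^n (1 - s) is its maximal value times
    r^n (1 + n (1 - r)), and beta_sh^2 (n + 2) is the inverse of that maximal
    value. *)
Lemma critical_lt n beta s : (0 < n)%N -> 0 < beta -> beta <= beta_sh n.+2 ->
  0 <= s -> s != s_star n.+2 ->
  beta ^+ 2 * (n%:R + 2) * s ^+ n * (1 - s) < 1.
Proof.
move=> n0 b0 bb s0; rewrite s_starE => ss.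
have N0 : 0 < n%:R :> R by rewrite ltr0n.
have N1 : 0 < n%:R + 1 :> R by lra.
have hb := le_beta_sh_sqr n0 b0 bb.
pose r := s * (n%:R + 1) / n%:R.
have sE : s = r * n%:R / (n%:R + 1) by rewrite /r; field; rewrite !gt_eqF.
have r0 : 0 <= r by rewrite /r divr_ge0// ?mulr_ge0// ltW.
have r1 : r != 1.
  by apply: contra ss => /eqP r1; rewrite sE r1 mul1r.
have h := amgm_lt n0 r0 r1.
clearbody r.
have b1 : 0 < beta ^+ 2 * (n%:R + 2) * n%:R ^+ n.
  by rewrite !mulr_gt0 ?exprn_gt0//; lra.
have -> : beta ^+ 2 * (n%:R + 2) * s ^+ n * (1 - s) =
    beta ^+ 2 * (n%:R + 2) * n%:R ^+ n / (n%:R + 1) ^+ n.+1 *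
    (r ^+ n * (1 + n%:R * (1 - r))).
  rewrite sE expr_div_n [(r * _) ^+ n]exprMn [_ ^+ n.+1]exprS.
  by have := exprn_gt0 n N1; move: (_ ^+ n) => A A0; field; rewrite !gt_eqF.
have le1 : beta ^+ 2 * (n%:R + 2) * n%:R ^+ n / (n%:R + 1) ^+ n.+1 <= 1.
  by rewrite ler_pdivrMr ?exprn_gt0// mul1r.
have gt0 : 0 < beta ^+ 2 * (n%:R + 2) * n%:R ^+ n / (n%:R + 1) ^+ n.+1.
  by rewrite divr_gt0 ?exprn_gt0.
move: (_ / _) (r ^+ n * _) le1 gt0 h => X Y; nra.
Qed.

(** With y = n - s (n + 1) > 0, the logarithm is ln (1 + y) >= y / (1 + y),
    while the other term is - B (s (n + 1) / n) y / (1 + y), with both B and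
    s (n + 1) / n less than 1. *)
Lemma crest_gt0 n beta s : (0 < n)%N -> 0 < beta -> beta <= beta_sh n.+2 ->
  0 <= s -> s < s_star n.+2 -> 0 < crest n beta s 1.
Proof.
move=> n0 b0 bb s0 ss.
have B1 := critical_lt n0 b0 bb s0 (negbT (lt_eqF ss)).
move: ss; rewrite s_starE => ss.
have N0 : 0 < n%:R :> R by rewrite ltr0n.
have N1 : 0 < n%:R + 1 :> R by lra.
have sN : s * (n%:R + 1) < n%:R by rewrite -ltr_pdivlMr.
have s1 : s < 1 by nra.
rewrite crest1E//.
pose y := n%:R - s * (n%:R + 1).
have y0 : 0 < y by rewrite subr_gt0.
have -> : (n%:R + 1) * (1 - s) = 1 + y by rewrite /y; ring.
have lny : y / (1 + y) <= ln (1 + y).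
  have := @le_ln1Dx R (- (y / (1 + y))).
  rewrite (_ : 1 + - (y / (1 + y)) = (1 + y)^-1); last first.
    by field; rewrite gt_eqF//; lra.
  rewrite lnV ?posrE; last by lra.
  rewrite lerN2; apply.
  by rewrite ltrN2 ltr_pdivrMr; lra.
set B := beta ^+ 2 * _ * _ * _ in B1.
have B0 : 0 <= B.
  by rewrite /B !mulr_ge0 ?sqr_ge0 ?exprn_ge0//; lra.
have -> : beta ^+ 2 * (n%:R + 2) * s ^+ n.+1 * (s * (n%:R + 1) / n%:R - 1) =
    - (B * (s * (n%:R + 1)) / n%:R * (y / (1 + y))).
  rewrite /B /y [s ^+ n.+1]exprS; field; rewrite !gt_eqF//; lra.
have yy : 0 < y / (1 + y) by rewrite divr_gt0//; lra.
have BN : B * (s * (n%:R + 1)) / n%:R < 1.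
  rewrite ltr_pdivrMr// mul1r.
  have : 0 <= s * (n%:R + 1) by rewrite mulr_ge0// ltW.
  move: (s * _) sN => X XN X0; nra.
move: (_ / _) (B * _ / _) yy BN lny => Y X; nra.
Qed.

(** At (n + 1)(1 - s) z = 1 the crest vanishes and its derivative in z is
    positive because B < 1. Hence a slightly smaller z makes it negative, and
    z >= 1 is preserved because s > s_*. *)
Lemma crest_lt0 n beta s : (0 < n)%N -> 0 < beta -> beta <= beta_sh n.+2 ->
  s_star n.+2 < s -> s < 1 -> exists2 z, 1 <= z & crest n beta s z < 0.
Proof.
move=> n0 b0 bb ss s1.
have N0 : 0 < n%:R :> R by rewrite ltr0n.
have N1 : 0 < n%:R + 1 :> R by lra.
have s0 : 0 < s.
  by apply: lt_trans ss; rewrite s_starE divr_gt0.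
have B1 := critical_lt n0 b0 bb (ltW s0) (negbT (gt_eqF ss)).
move: ss; rewrite s_starE ltr_pdivrMr// => ss.
set B := beta ^+ 2 * _ * _ * _ in B1.
have B0 : 0 <= B.
  by rewrite /B !mulr_ge0 ?sqr_ge0 ?exprn_ge0//; lra.
(* the first bound gives B s < s - e, the second gives 1 <= z *)
pose e := Num.min (s * (1 - B) / 2) (1 - (n%:R + 1) * (1 - s)).
have e0 : 0 < e.
  rewrite lt_min divr_gt0 ?mulr_gt0 ?subr_gt0//=; lra.
have e1 : e <= s * (1 - B) / 2 by rewrite ge_min lexx.
have e2 : e <= 1 - (n%:R + 1) * (1 - s) by rewrite ge_min lexx orbT.
pose z := (1 - e) / ((n%:R + 1) * (1 - s)).
have d0 : 0 < (n%:R + 1) * (1 - s) by rewrite mulr_gt0// subr_gt0.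
exists z; first by rewrite ler_pdivlMr// mul1r; lra.
have es : B * s < s - e by nra.
have se : 0 < s - e by apply: le_lt_trans es; rewrite mulr_ge0// ltW.
have e_lt1 : e < 1 by lra.
have lnE : ln ((n%:R + 1) * (1 - s)) + ln z = ln (1 - e).
  rewrite -lnM ?posrE ?divr_gt0 ?subr_gt0//.
  by rewrite /z mulrC divfK// gt_eqF.
have ln_le : ln (1 - e) <= - e.
  by rewrite le_ln1Dx// ltrN2.
rewrite /crest lnE.
have -> : beta ^+ 2 * s ^+ n.+1 / 2 * (s * (n%:R + 1) * (z + 1) /
    ((n%:R + 1) * z - 1) - s - (n%:R + 2) * (1 - s)) = B * s / (s - e) * e / 2.
  rewrite /B /z [s ^+ n.+1]exprS; field.
  rewrite !gt_eqF//; nra.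
have : B * s / (s - e) < 1 by rewrite ltr_pdivrMr// mul1r.
move: (B * s / (s - e)) => X X1; nra.
Qed.

Lemma u_starE n beta : (0 < n)%N ->
  u_star n.+2 beta = tilt n beta (s_star n.+2) / curv n 1.
Proof.
move=> n0; have N0 : 0 < n%:R :> R by rewrite ltr0n.
have ss0 : 0 <= s_star n.+2 :> R by rewrite s_starE divr_ge0// addr_ge0.
rewrite /u_star /tilt.
have -> : s_star n.+2 `^ (n.+2%:R / 2) = Num.sqrt (s_star n.+2) ^+ n.+2 :> R.
  by rewrite [n.+2%:R / 2]mulrC powRrM powR12_sqrt// powR_mulrn// sqrtr_ge0.
rewrite natS2 /curv; field.
rewrite !gt_eqF//; lra.
Qed.

Lemma crest_s_star n beta : (0 < n)%N -> crest n beta (s_star n.+2) 1 = 0.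
Proof.
move=> n0; have N0 : 0 < n%:R :> R by rewrite ltr0n.
have N1 : 0 < n%:R + 1 :> R by lra.
rewrite crest1E//; last by rewrite s_starE ltr_pdivrMr// mul1r; lra.
rewrite s_starE divfK ?gt_eqF// divff ?gt_eqF// subrr mulr0.
rewrite (_ : (n%:R + 1) * _ = 1) ?ln1 ?mul0r ?addr0//.
by field; rewrite gt_eqF.
Qed.

Lemma Phi_has_sup n beta s : (0 < n)%N -> 0 <= s -> s < 1 ->
  has_sup [set Phi n.+2 beta u (Num.sqrt s) | u in [set: R]].
Proof.
move=> n0 s0 s1; split; first by exists (Phi n.+2 beta 0 (Num.sqrt s)), 0.
exists (crest n beta s 1 + beta ^+ 2 / 2) => _ [u _ <-].
rewrite -lerBlDr (le_trans (Phi_le beta u n0 (lexx 1) s0 s1))//.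
by rewrite gerBl mulr_ge0 ?sqr_ge0// divr_ge0// ltW// curv_gt0.
Qed.

Lemma Delta_ge n beta s u : (0 < n)%N -> 0 <= s -> s < 1 ->
  Phi n.+2 beta u (Num.sqrt s) - beta ^+ 2 / 2 <= Delta n.+2 beta s.
Proof.
move=> n0 s0 s1; rewrite lerB//.
by apply: sup_upper_bound; [exact: Phi_has_sup|exists u].
Qed.

Lemma Delta_le n beta s z : (0 < n)%N -> 1 <= z -> 0 <= s -> s < 1 ->
  Delta n.+2 beta s <= crest n beta s z.
Proof.
move=> n0 z1 s0 s1; rewrite lerBlDr.
apply: sup_le_ub; first by have [] := Phi_has_sup beta n0 s0 s1.
move=> _ [u _ <-].
rewrite -lerBlDr (le_trans (Phi_le beta u n0 z1 s0 s1))//.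
by rewrite gerBl mulr_ge0 ?sqr_ge0// divr_ge0// ltW// curv_gt0.
Qed.

(** Below s_* the vertex of the quadratic is in the bulk, where the bound is
    attained. *)
Lemma Delta_eq n beta s : (0 < n)%N -> 0 < beta -> beta <= beta_sh n.+2 ->
  0 <= s -> s <= s_star n.+2 -> s < 1 -> Delta n.+2 beta s = crest n beta s 1.
Proof.
move=> n0 b0 bb s0 ss s1; apply/eqP; rewrite eq_le Delta_le//=.
rewrite (le_trans _ (Delta_ge beta (tilt n beta s / curv n 1) n0 s0 s1))//.
by rewrite Phi_eq// ?tilt_bulk// subrr expr0n/= mulr0 subr0.
Qed.

End energy_sup.

(** * The sign of the overlap functional *)

Theorem proposition5p1 (R : realType) (p : nat) (hp : (3 <= p)%N) :
  (forall beta : R, 0 < beta -> beta <= beta_sh p ->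
    (forall s : R, 0 <= s -> s < 1 ->
      has_sup [set Phi p beta u (Num.sqrt s) | u in [set: R]] /\
      Num.sg (Delta p beta s) =
        if s < s_star p then 1 else if s == s_star p then 0 else -1) /\
    (forall u : R,
      (forall w : R,
        Phi p beta w (Num.sqrt (s_star p)) <= Phi p beta u (Num.sqrt (s_star p)))
      <-> u = u_star p beta)) /\
  u_star p (beta_sh p) = u_infty p :> R.
Proof.
case: p hp => [|[|n]]// n0; rewrite ltnS in n0.
have N0 : 0 < n%:R :> R by rewrite ltr0n.
have N1 : 0 < n%:R + 1 :> R by lra.
have ss0 : 0 <= s_star n.+2 :> R by rewrite s_starE divr_ge0// ltW.
have ss1 : s_star n.+2 < 1 :> R by rewrite s_starE ltr_pdivrMr// mul1r; lra.
split; last first.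
  apply/eqP; rewrite -(@eqrXn2 _ 2)//; last 2 first.
  - rewrite u_starE// divr_ge0 ?(ltW (curv_gt0 _ _))//.
    by rewrite mulr_ge0 ?exprn_ge0 ?sqrtr_ge0.
  - by rewrite mulr_ge0 ?sqrtr_ge0.
  rewrite u_starE// expr_div_n sqr_tilt// beta_sh_sqr.
  rewrite /u_infty [(2 * Num.sqrt _) ^+ 2]exprMn sqr_sqrtr; last first.
    by rewrite natS2 divr_ge0//; lra.
  rewrite s_starE expr_div_n natS2 /curv ![_ ^+ n.+2]exprS ![_ ^+ n.+1]exprS.
  have := exprn_gt0 n N0; have := exprn_gt0 n N1.
  move: (_ ^+ n) (_ ^+ n) => A B A0 B0.
  apply/eqP; field.
  by rewrite !gt_eqF//; lra.
move=> beta b0 bb; split=> [s s0 s1|u].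
  split; first exact: Phi_has_sup.
  case: ltgtP => [ss|ss|ss].
  - by rewrite Delta_eq// ?ltW// gtr0_sg// crest_gt0.
  - have [z z1 cz] := crest_lt0 n0 b0 bb ss s1.
    by rewrite ltr0_sg// (le_lt_trans _ cz)// Delta_le.
  - by rewrite ss Delta_eq// crest_s_star// sgr0.
have Pstar : Phi n.+2 beta (u_star n.+2 beta) (Num.sqrt (s_star n.+2)) -
    beta ^+ 2 / 2 = 0.
  rewrite Phi_eq// u_starE ?tilt_bulk//.
  by rewrite subrr expr0n/= mulr0 subr0 crest_s_star.
have Ple w : Phi n.+2 beta w (Num.sqrt (s_star n.+2)) - beta ^+ 2 / 2 <=
    - (curv n 1 / 2 * (w - u_star n.+2 beta) ^+ 2).
  rewrite (le_trans (Phi_le beta w n0 (lexx 1) ss0 ss1))//.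
  by rewrite crest_s_star// sub0r u_starE.
have k0 : 0 < curv n 1 / 2 :> R by rewrite divr_gt0// curv_gt0.
split=> [umax|-> w]; last first.
  rewrite -(lerD2r (- (beta ^+ 2 / 2))) Pstar (le_trans (Ple w))//.
  by rewrite oppr_le0 mulr_ge0 ?sqr_ge0// ltW.
have := umax (u_star n.+2 beta).
rewrite -(lerD2r (- (beta ^+ 2 / 2))) Pstar => /le_trans/(_ (Ple u)).
rewrite oppr_ge0 pmulr_rle0// => h.
by apply/eqP; rewrite -subr_eq0 -sqrf_eq0 eq_le h sqr_ge0.
Qed.
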